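(* Every $d$-regular adjacency matrix $A$ has a signing $A_s$ with $$\lambda_{\max}(A_s)\le 2\sqrt{d-1}.$$
   Context: The adjacency matrix of a finite undirected graph $G=(V,E)$ is the symmetric matrix $A$ with rows and columns indexed by $V$ and with $A(a,b)=1$ if $(a,b)\in E$ and $A(a,b)=0$ otherwise. A $d$-regular adjacency matrix is the adjacency matrix of a $d$-regular graph, i.e. a graph in which every vertex has exactly $d$ neighbors. Write $A=\sum_{(a,b)\in E}A_{(a,b)}$, where $A_{(a,b)}$ is the adjacency matrix of the graph on vertex set $V$ whose only edge is $(a,b)$. A signing of $A$ is any matrix of the form $A_s=\sum_{(a,b)\in E}s_{(a,b)}A_{(a,b)}$ with signs $s_{(a,b)}\in\{-1,+1\}$. $\lambda_{\max}$ denotes the largest eigenvalue.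
   Formalization: The formal theorem assumes d ≥ 2 and a nonempty vertex set: for d = 1 the claim fails (every signing of a single edge has largest eigenvalue 1 > 0), for d = 0 the bound is the root of −1, and with no vertices there is no largest eigenvalue. *)

(* Defs.v *)
From HB Require Import structures.
From mathcomp Require Import all_boot all_order all_algebra.
From mathcomp Require Import reals.

Set Implicit Arguments.
Unset Strict Implicit.
Unset Printing Implicit Defensive.

Import Order.TTheory GRing.Theory Num.Theory.
Local Open Scope ring_scope.

(* An undirected edge (a, b) is the unordered pair [set a; b], so a graph on V
   is a set E of two-element subsets of V. *)
Definition simple_graph (V : finType) (E : {set {set V}}) : Prop :=
  forall e, e \in E -> #|e| = 2%N.

Definition neighbors (V : finType) (E : {set {set V}}) (a : V) : {set V} :=
  [set b | [set a; b] \in E].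

Definition regular (V : finType) (d : nat) (E : {set {set V}}) : Prop :=
  forall a, #|neighbors E a| = d.

(* Rows and columns are indexed by V through the enumeration 'I_#|V| -> V. *)
Definition adjmx (R : realType) (V : finType) (E : {set {set V}}) :
    'M[R]_#|V| :=
  \matrix_(i, j) ([set enum_val i; enum_val j] \in E)%:R.

(* Only the values of s on E matter. *)
Definition signed_adjmx (R : realType) (V : finType) (E : {set {set V}})
    (s : {set V} -> R) : 'M[R]_#|V| :=
  \sum_(e in E) s e *: adjmx R [set e].

Definition is_signing (R : realType) (V : finType) (E : {set {set V}})
    (B : 'M[R]_#|V|) : Prop :=
  exists2 s : {set V} -> R,
    forall e, e \in E -> s e = 1 \/ s e = -1 & B = signed_adjmx E s.

Definition is_lambda_max (R : realType) (n : nat) (M : 'M[R]_n) (l : R) : Prop :=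
  eigenvalue M l /\ forall a : R, eigenvalue M a -> a <= l.

Lemma signed_adjmx1 (R : realType) (V : finType) (E : {set {set V}}) :
  signed_adjmx E (fun=> 1 : R) = adjmx R E.
Proof.
apply/matrixP => i j; rewrite summxE mxE.
under eq_bigr do rewrite !mxE mul1r in_set1.
set p := [set _; _]; case: (boolP (p \in E)) => pE.
  by rewrite (bigD1 p) //= eqxx big1 ?addr0 // => e /andP[_ /negPf];
     rewrite eq_sym => ->.
by rewrite big1 // => e eE; case: eqP => // pe; rewrite pe eE in pE.
Qed.

(* Main.v *)
Require Import Defs.
From HB Require Import structures.
From mathcomp Require Import all_boot all_order all_algebra perm.
From mathcomp Require Import reals.
From mathcomp Require Import complex polyrcf ring lra.
From mathcomp Require Import boolp topology normedtype derive.

(** Choose the signs of the edges independently and uniformly at random, and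
    average the characteristic polynomials of the resulting signings.  The
    argument has two independent halves.

    The average has no root beyond [2 * sqrt (d - 1)].  It is in fact the
    matching polynomial of the graph: for a principal minor on a vertex set
    [S], averaging over the sign of an edge inside [S] keeps the term without
    that edge and subtracts the minor with both ends removed ([pdet_edge]),
    hence the vertex recursion
    [f S = x * f (S - u) - \sum_(uv inside S) f (S - u - v)]
    ([avg_pdet_vertex]).  By induction on [S] the ratio [f S / f (S - u)] is at
    least [sqrt (d - 1)] as long as [u] has an edge leaving [S]
    ([avg_pdet_ratio]), because at most [d - 1] terms then remain in the sum.

    Some signing does no worse than the average.  Fix the signs one edge at a
    time; at each stage the current average is the mean of the averages [f1]
    and [f2] for the two signs of the next edge, and one of [f1], [f2] must have
    no root beyond a bound that the mean respects ([sign_choice]).  In general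
    the largest root of a mean says nothing about its terms; here it does
    because both polynomials compare with a common one.  With
    [D] the projection onto the two coordinates of an edge of adjacency matrix
    [A], both [D - A] and [D + A] are rank one Gram matrices, so that
    [M + A] and [M - A] are obtained from [M + D] by subtracting a positive
    semidefinite rank one matrix.  Averaged determinants do not vanish on
    matrices with positive definite imaginary part ([avg_stable]), from which
    it follows that [q = f1 - a], with [a] the average at [M + D], satisfies
    [q' a - q a' >= 0] on the real line ([gram_nevanlinna]): [q / a] has simple
    real poles with negative residues.  Therefore [f1 / a] and
    [f2 / a] are nondecreasing to the right of the last root of [a], and
    neither [f1] nor [f2] is positive at this root; a root of [f1] and a root
    of [f2] beyond the bound would then force a nonpositive value of the mean
    there ([nevanlinna_choice]).

    When all the signs are fixed, the characteristic polynomial of the signing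
    is positive beyond [2 * sqrt (d - 1)]. *)

Set Implicit Arguments.
Unset Strict Implicit.
Unset Printing Implicit Defensive.

Import Order.TTheory GRing.Theory Num.Theory.
Import numFieldNormedType.Exports.
Local Open Scope ring_scope.

(** * Random signs and rank one updates *)

Section SignAverage.
Variables (F : numFieldType) (n : nat).
Implicit Types (l : seq ('I_n * 'I_n)) (f g : 'M[F]_n -> F) (M N : 'M[F]_n).

Definition edge_mx (p : 'I_n * 'I_n) : 'M[F]_n :=
  delta_mx p.1 p.2 + delta_mx p.2 p.1.

(** Averaging one edge at a time, rather than over all sign vectors at once,
    makes the partial averages met when signs are fixed successively instances
    of the same function. *)
Fixpoint avg l f M : F :=
  if l is p :: l' then (avg l' f (M + edge_mx p) + avg l' f (M - edge_mx p)) / 2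
  else f M.

Definition sum_row (p : 'I_n * 'I_n) : 'rV[F]_n := delta_mx 0 p.1 + delta_mx 0 p.2.
Definition diff_row (p : 'I_n * 'I_n) : 'rV[F]_n := delta_mx 0 p.1 - delta_mx 0 p.2.
(** The degree matrix of the graph with the single edge [p]. *)
Definition ends_mx (p : 'I_n * 'I_n) : 'M[F]_n :=
  delta_mx p.1 p.1 + delta_mx p.2 p.2.

Lemma sum_rowM p : (sum_row p)^T *m sum_row p = ends_mx p + edge_mx p.
Proof.
rewrite /sum_row [(_ + _)^T]raddfD /= !trmx_delta mulmxDr !mulmxDl !mul_delta_mx.
by apply/matrixP => i j; rewrite !mxE; ring.
Qed.

Lemma diff_rowM p : (diff_row p)^T *m diff_row p = ends_mx p - edge_mx p.
Proof.
rewrite /diff_row [(_ - _)^T]raddfB /= !trmx_delta mulmxBr !mulmxBl !mul_delta_mx.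
by apply/matrixP => i j; rewrite !mxE; ring.
Qed.

(** [M + s *: (c *m r)] is the Schur complement of a bordered matrix in which
    [s] occurs in the first row only. *)
Lemma det_rank1_affine s M (c : 'cV[F]_n) (r : 'rV[F]_n) :
  \det (M + s *: (c *m r)) = (1 - s) * \det M + s * \det (M + c *m r).
Proof.
pose B t : 'M[F]_(1 + n) := block_mx 1 (t *: r) (- c) M.
have detB t : \det (B t) = \det (M + t *: (c *m r)).
  have -> : B t = block_mx 1 0 (- c) 1 *m block_mx 1 (t *: r) 0 (M + t *: (c *m r)).
    rewrite mulmx_block !mul1mx !mul0mx !mulmx1 ?mulmx0 !addr0.
    by rewrite mulNmx -scalemxAr addrC addrK.
  by rewrite det_mulmx det_lblock det_ublock !det1 !mul1r.
have detB1 := detB 1; rewrite scale1r in detB1.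
have detB0 := detB 0; rewrite scale0r addr0 in detB0.
rewrite -detB -detB1 -detB0.
have dropB t : row' (lshift n 0) (B t) = row' (lshift n 0) (B 0).
  apply/matrixP => i j; rewrite !mxE.
  by case: splitP => // k; rewrite (ord1 k) /= /bump leq0n.
apply: (@determinant_multilinear _ _ _ _ _ (lshift n 0)).
- apply/rowP => j; rewrite !mxE; case: splitP => //= k _; rewrite ?ord1 ?mxE.
  case: splitP => k' _; rewrite !mxE ?mul0r ?mulr0 ?mul1r ?add0r //; ring.
- by rewrite dropB.
- by rewrite dropB [RHS]dropB.
Qed.

(** Averaging only involves the determinant at translates of [M], so it
    inherits affinity along rank one directions. *)
Lemma avg_rank1_affine l (s : F) M (c : 'cV[F]_n) (r : 'rV[F]_n) :
  avg l determinant (M + s *: (c *m r)) =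
  (1 - s) * avg l determinant M + s * avg l determinant (M + c *m r).
Proof.
elim: l M => [|p l IH] M /=; first exact: det_rank1_affine.
by rewrite !(addrAC M (s *: _)) !(addrAC M (c *m r)) !IH; field.
Qed.

(** Affinity in each of two rank one directions makes the average quadratic on
    their diagonal. Its constant and linear coefficients add up to the mean of
    the two endpoints, and this is the combination to which [quadratic_stable]
    applies. *)
Lemma avg_affine2 l M (u v : 'rV[F]_n) (a b : F) :
  a = avg l determinant M ->
  b = avg l determinant (M - u^T *m u) / 2 + avg l determinant (M - v^T *m v) / 2 - a ->
  exists c, forall s : F,
  avg l determinant (M - (s / 2) *: (u^T *m u + v^T *m v)) = a + b * s + c * s ^+ 2.
Proof.
move=> -> ->.
set P := u^T *m u; set Q := v^T *m v; set phi := avg l determinant.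
exists ((phi M - phi (M - P) - phi (M - Q) + phi (M - Q - P)) / 4) => t.
have aff N (w : 'rV[F]_n) x :
    phi (N - x *: (w^T *m w)) = (1 - x) * phi N + x * phi (N - w^T *m w).
  by rewrite -!mulNmx -scalerN -mulNmx; apply: avg_rank1_affine.
by rewrite scalerDr opprD addrA aff aff (addrAC M) aff -/P -/Q; field.
Qed.

End SignAverage.

(** * Averaged determinants do not vanish in the upper half plane *)

Section Stability.
Variable R : rcfType.
Local Notation C := R[i].
Local Notation Re := (@complex.Re R).
Local Notation Im := (@complex.Im R).

Lemma ImD (x y : C) : Im (x + y) = Im x + Im y.
Proof. by case: x y => [a b] [c d]. Qed.

Lemma ImM_real (s r : C) : Im r = 0 -> Im (s * r) = Im s * Re r.
Proof. by case: s r => [a b] [c d] /= ->; rewrite mulr0 add0r mulrC mulrC. Qed.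

Lemma Im_inv_le0 (z : C) : 0 <= Im z -> Im z^-1 <= 0.
Proof.
case: z => a b /= b0.
by rewrite oppr_le0 mulr_ge0 // invr_ge0 addr_ge0 ?sqr_ge0.
Qed.

(** The reciprocals of the roots would add up to [- b / a = 1] if [a + b]
    vanished, whereas all of them would have negative imaginary part. *)
Lemma quadratic_stable (a b c : C) :
  (forall s : C, Im s <= 0 -> a + b * s + c * s ^+ 2 != 0) -> a + b != 0.
Proof.
move=> nz; apply/eqP => /eqP; rewrite addrC addr_eq0 => /eqP ba; subst b.
have a0 : a != 0 by have := nz 0 (lexx _); rewrite mulr0 expr0n mulr0 !addr0.
have [c0|c0] := eqVneq c 0.
  by have /eqP[] := nz 1 (lexx _); rewrite c0 mulr1 mul0r addr0 subrr.
have [d [d0 d2]] : exists d : C, 0 <= Im d /\ d ^+ 2 = 1 - 4 * (c / a).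
  (* A square root of the discriminant of [y ^+ 2 - y + c / a], whose roots
     are the reciprocals; its sign is chosen to put [(1 + d) / 2] in the closed
     upper half plane. *)
  pose d0 := sqrtc (1 - 4 * (c / a)).
  have [h|h] := leP 0 (Im d0); first by exists d0; rewrite sqr_sqrtc.
  exists (- d0); rewrite sqrrN sqr_sqrtc; split=> //.
  by case: d0 h => u v /=; lra.
pose y := (1 + d) / 2.
have y2 : y ^+ 2 = y - c / a.
  rewrite /y; apply/eqP; rewrite -subr_eq0; apply/eqP.
  have -> : ((1 + d) / 2) ^+ 2 - ((1 + d) / 2 - c / a) = (d ^+ 2 - (1 - 4 * (c / a))) / 4.
    by field.
  by rewrite d2 subrr mul0r.
have y0 : y != 0.
  apply/eqP => y0; move: y2; rewrite y0 expr0n /= sub0r => /eqP.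
  by rewrite eq_sym oppr_eq0 mulf_eq0 invr_eq0 (negPf c0) (negPf a0).
have Iy : 0 <= Im y.
  have -> : y = (2^-1)%:C%C * (1 + d) by rewrite fmorphV rmorph_nat mulrC.
  rewrite mulrC ImM_real //= mulr_ge0 ?invr_ge0 ?ler0n //.
  by case: (d) d0 => u v /=; rewrite add0r.
have /eqP[] := nz y^-1 (Im_inv_le0 Iy).
have ->: c = a * (y - y ^+ 2) by rewrite y2 opprB addrC subrK mulrC divfK.
by field; rewrite y0.
Qed.

Variable n : nat.
Implicit Types (M H P : 'M[C]_n) (w : 'rV[C]_n).

(** The hermitian form [w M w^*]; row vectors match the left kernels by which
    singular matrices are described. *)
Definition hform M w : C := (w *m M *m (map_mx conjc w)^T) 0 0.
(** Positive definiteness of the anti-hermitian part, the matrix analogue of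
    the open upper half plane. *)
Definition pos_im M := forall w, w != 0 -> 0 < Im (hform M w).
Definition psd P := forall w, 0 <= hform P w.
Definition hermitian H := forall w, Im (hform H w) = 0.

Lemma hformD M N w : hform (M + N) w = hform M w + hform N w.
Proof. by rewrite /hform mulmxDr mulmxDl mxE. Qed.
Lemma hformZ s M w : hform (s *: M) w = s * hform M w.
Proof. by rewrite /hform -scalemxAr -scalemxAl mxE. Qed.

Lemma psd_hermitian P : psd P -> hermitian P.
Proof. by move=> hP w; apply: ger0_Im. Qed.

Lemma pos_imD M s P : pos_im M -> psd P -> 0 <= Im s -> pos_im (M + s *: P).
Proof.
move=> hM hP hs w w0; rewrite hformD hformZ.
rewrite ImD ImM_real; last exact: psd_hermitian.
rewrite ltr_pwDl ?hM // mulr_ge0 //.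
by have := hP w; rewrite lecE => /andP[].
Qed.

Lemma pos_im_hermitian M H : pos_im M -> hermitian H -> pos_im (M + H).
Proof.
move=> hM hH w w0; rewrite hformD.
by rewrite ImD hH addr0 hM.
Qed.

Lemma pos_im_det M : pos_im M -> \det M != 0.
Proof.
move=> hM; apply/det0P => -[w w0 wM].
by have := hM w w0; rewrite /hform wM mul0mx mxE ltxx.
Qed.

Lemma psdD P N : psd P -> psd N -> psd (P + N).
Proof. by move=> hP hN w; rewrite hformD addr_ge0. Qed.

Lemma psdZ s P : 0 <= s -> psd P -> psd (s *: P).
Proof. by move=> s0 hP w; rewrite hformZ mulr_ge0. Qed.

Lemma psd_gram (u : 'rV[C]_n) : map_mx conjc u = u -> psd (u^T *m u).
Proof.
move=> ur w; rewrite /hform mulmxA -mulmxA mxE big_ord1 -{2}ur.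
rewrite -[map_mx conjc u *m _]trmxK trmx_mul trmxK map_trmx -map_mxM.
by rewrite !mxE mulcJ_ge0.
Qed.

Lemma hermitian_real H : map_mx conjc H = H -> H^T = H -> hermitian H.
Proof.
move=> Hr Hs w.
suff : conjc (hform H w) = hform H w.
  by case: (hform H w) => a b /eqP; rewrite eq_complex /= => /andP[_ /eqP]; lra.
have WW : map_mx conjc (map_mx conjc w) = w.
  by apply/matrixP => i j; rewrite !mxE conjcK.
have E : map_mx conjc (w *m H *m (map_mx conjc w)^T) = (w *m H *m (map_mx conjc w)^T)^T.
  by rewrite !map_mxM Hr -map_trmx WW !trmx_mul trmxK Hs mulmxA.
by move/matrixP/(_ 0 0): E; rewrite [LHS]mxE [RHS]mxE.
Qed.

Lemma pos_im_scalar (z : C) : 0 < Im z -> pos_im z%:M.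
Proof.
move=> hz w w0; rewrite -scalemx1 hformZ.
have h0 : 0 < hform 1 w.
  rewrite /hform mulmx1 mxE.
  have /rV0Pn[j wj] := w0.
  rewrite (bigD1 j) //= ltr_pwDl //.
    by rewrite lt_def mulf_neq0 ?mxE ?conjc_eq0 // mulcJ_ge0.
  by apply: sumr_ge0 => k _; rewrite !mxE mulcJ_ge0.
rewrite ImM_real; last by apply/ger0_Im/ltW.
by rewrite mulr_gt0 //; move: h0; rewrite ltcE => /andP[].
Qed.

Local Notation edge_mx := (@edge_mx C n).
Local Notation ends_mx := (@ends_mx C n).

(** Half the sum of the Gram matrices of [e_a - e_b] and [e_a + e_b]; this is
    what couples the two signs of an edge to a single direction [ends_mx]. *)
Lemma ends_mxE p : ends_mx p =
  2^-1 *: ((diff_row C p)^T *m diff_row C p + (sum_row C p)^T *m sum_row C p).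
Proof.
rewrite diff_rowM sum_rowM addrACA addNr addr0.
by apply/matrixP => i j; rewrite !mxE; field.
Qed.

Lemma sum_row_real p : map_mx conjc (sum_row C p) = @sum_row C n p.
Proof. by rewrite map_mxD !map_delta_mx. Qed.

Lemma diff_row_real p : map_mx conjc (diff_row C p) = @diff_row C n p.
Proof. by rewrite map_mxB !map_delta_mx. Qed.

Lemma psd_sum p : psd ((sum_row C p)^T *m sum_row C p).
Proof. exact/psd_gram/sum_row_real. Qed.

Lemma psd_diff p : psd ((diff_row C p)^T *m diff_row C p).
Proof. exact/psd_gram/diff_row_real. Qed.

Lemma psd_ends p : psd (ends_mx p).
Proof.
rewrite ends_mxE; apply: psdZ; first by rewrite invr_ge0 ler0n.
exact: psdD (psd_diff p) (psd_sum p).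
Qed.

(** Induction on the edges. With [N := M + ends_mx p], both signs of the edge
    [p] subtract a rank one Gram matrix from [N]. On the diagonal
    [N - s *: ends_mx p] of these two directions the average over the other
    edges is quadratic in [s], and for [s] in the closed lower half plane the
    matrix still has positive imaginary part, so that the average is not zero. *)
Theorem avg_stable l M : pos_im M -> avg l determinant M != 0.
Proof.
elim: l M => [|p l IH] M hM; first exact: pos_im_det.
pose N := M + ends_mx p.
have diffE : N - (diff_row C p)^T *m diff_row C p = M + edge_mx p.
  by rewrite diff_rowM opprB addrC /N [M + _]addrC addrA subrK addrC.
have sumE : N - (sum_row C p)^T *m sum_row C p = M - edge_mx p.
  by rewrite sum_rowM opprD addrA addrK.
have [c hc] := @avg_affine2 C n l N (diff_row C p) (sum_row C p) _ _ erefl erefl.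
have -> : avg (p :: l) determinant M = avg l determinant N +
  (avg l determinant (N - (diff_row C p)^T *m diff_row C p) / 2
   + avg l determinant (N - (sum_row C p)^T *m sum_row C p) / 2 - avg l determinant N).
  by rewrite addrC subrK diffE sumE -mulrDl.
apply: (@quadratic_stable _ _ c) => s hs; rewrite -hc; apply: IH.
rewrite -scalerA -ends_mxE /N -addrA -[X in X - _]scale1r -scalerBl.
apply: pos_imD => //; first exact: psd_ends.
by case: s hs {hc} => a b /= hb; lra.
Qed.

End Stability.

(** * Monotone quotients of real polynomials *)

Section Polynomials.
Variable R : realType.
Local Notation C := R[i].
Local Notation Im := (@complex.Im R).
Local Notation toC := (map_poly (real_complex R)).
Implicit Types (a p q f : {poly R}).

(** Splitting the Taylor expansion at [x] into even and odd powers of [i y]. *)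
Lemma horner_complex p (x : R) : exists e o : {poly R},
  [/\ e.[0] = p.[x], o.[0] = p^`().[x] &
      forall y, (toC p).[(x +i* y)%C] = (e.[y] +i* (y * o.[y]))%C].
Proof.
elim/poly_ind: p => [|p c [e [o [e0 o0 pE]]]].
  exists 0, 0; rewrite deriv0 !horner0; split=> // y.
  by rewrite rmorph0 !horner0 mulr0.
exists (x *: e - 'X^2 * o + c%:P), (e + x *: o); split.
- by rewrite !hornerE e0 expr0n /= mul0r oppr0 addr0 mulrC.
- by rewrite derivD derivM derivX derivC !hornerE e0 o0 /= addrC mulrC.
- move=> y; rewrite rmorphD rmorphM /= map_polyX map_polyC /= !hornerE pE.
  by apply/eqP; rewrite eq_complex /=; apply/andP; split; apply/eqP; ring.
Qed.

(** Continuity from the right. *)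
Lemma horner_ge0_right p (x : R) : (forall y, x < y -> 0 <= p.[y]) -> 0 <= p.[x].
Proof.
move=> h; rewrite leNgt; apply/negP => px.
have [d d0 hd] := @poly_cont R x p (- p.[x]) ltac:(by rewrite oppr_gt0).
have y0 : x < x + d / 2 by rewrite ltrDl divr_gt0.
have := hd (x + d / 2); rewrite addrAC subrr add0r ger0_norm; last by rewrite ltW // divr_gt0.
move=> /(_ ltac:(lra)); have := h _ y0; move: (p.[_]) px => t px t0.
rewrite ger0_norm; lra.
Qed.

(** At [x + i y] the imaginary part is [y] times a polynomial in [y] whose
    constant term is the Wronskian; let [y] tend to [0]. *)
Lemma wronskian_ge0 a q :
  (forall z : C, 0 < Im z -> 0 <= Im ((toC q).[z] * conjc (toC a).[z])) ->
  forall x, 0 <= q^`().[x] * a.[x] - q.[x] * a^`().[x].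
Proof.
move=> h x.
have [ea [oa [ea0 oa0 aE]]] := horner_complex a x.
have [eq [oq [eq0 oq0 qE]]] := horner_complex q x.
have := @horner_ge0_right (oq * ea - eq * oa) 0.
rewrite !hornerE ea0 oa0 eq0 oq0; apply=> y y0.
have := h (x +i* y)%C y0; rewrite aE qE /= !hornerE.
rewrite -(pmulr_rge0 (oq.[y] * _ - _) y0) => hy.
by apply: le_trans hy _; rewrite le_eqVlt; apply/orP; left; apply/eqP; ring.
Qed.

(** The derivative of [q / a] is the Wronskian divided by [a ^+ 2]. *)
Lemma ratio_ndecr a q (A : R) :
  (forall x, 0 <= q^`().[x] * a.[x] - q.[x] * a^`().[x]) ->
  (forall x, A < x -> 0 < a.[x]) ->
  forall x y, A < x -> x <= y -> q.[x] / a.[x] <= q.[y] / a.[y].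
Proof.
move=> W a0 x y Ax xy.
pose h t := q.[t] * (a.[t])^-1.
pose dh t := (q^`().[t] * a.[t] - q.[t] * a^`().[t]) / a.[t] ^+ 2.
have dhP t : A < t -> is_derive (t : R) (1 : R) h (dh t).
  move=> At; have a0' : a.[t] != 0 by rewrite gt_eqF // a0.
  have da : derivable (horner a) t 1 by exact: derivable_horner.
  have dq : derivable (horner q) t 1 by exact: derivable_horner.
  have dV := derivableV a0' da.
  apply: DeriveDef; first exact: derivableM.
  rewrite /h (@deriveM _ _ _ (fun z => (a.[z])^-1)) // deriveV //.
  rewrite (@derive_val _ _ _ _ _ _ _ (is_derive_poly a t)).
  rewrite (@derive_val _ _ _ _ _ _ _ (is_derive_poly q t)).
  by rewrite /dh /GRing.scale /=; field.
have [||c] := @MVT_segment R h dh x y xy.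
- move=> t; rewrite in_itv /= => /andP[xt _]; apply: dhP; exact: lt_trans xt.
- apply: derivable_within_continuous => t; rewrite in_itv /= => /andP[xt _].
  have dt : A < t by exact: lt_le_trans xt.
  by have [] := dhP t dt.
rewrite in_itv /= => /andP[xc _] hE.
rewrite -subr_ge0 -/(h x) -/(h y) hE mulr_ge0 ?subr_ge0 //.
by rewrite /dh mulr_ge0 // invr_ge0 sqr_ge0.
Qed.

Lemma seq_max (s : seq R) x : x \in s -> exists2 m, m \in s & forall y, y \in s -> y <= m.
Proof.
elim: s x => // b [|c s] IH x _.
  by exists b; [exact: mem_head|move=> y; rewrite inE => /eqP->].
have [m ms mM] := IH c (mem_head _ _).
have [bm|mb] := leP b m.
  exists m; first by rewrite inE ms orbT.
  by move=> y; rewrite inE => /predU1P[->|/mM].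
exists b; first exact: mem_head.
by move=> y; rewrite inE => /predU1P[->//|/mM /le_trans->//]; exact: ltW.
Qed.

Lemma poly_root_max p (x : R) : p != 0 -> root p x ->
  exists2 m, root p m & forall y, root p y -> y <= m.
Proof.
move=> p0 px.
have E y : root p y = (y \in rootsR p).
  by have := roots_on_rootsR p0 y; rewrite in_itv /= => ->.
have [m ms mM] : exists2 m, m \in rootsR p & forall y, y \in rootsR p -> y <= m.
  by apply: seq_max; rewrite -E; exact: px.
by exists m => [|y]; rewrite E //; exact: mM.
Qed.

Lemma monic_gt0_or_last_root a (B : R) : a \is monic ->
  (forall x, B < x -> 0 < a.[x]) \/
  exists r : R, [/\ B < r, a.[r] = 0 & forall x, r < x -> 0 < a.[x]].
Proof.
move=> am; have a0 := monic_neq0 am.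
have root_right x : a.[x] <= 0 -> exists2 y, x <= y & root a y.
  move=> ax.
  have [N hN] := @poly_pinfty_gt_lc R a ltac:(by rewrite (monicP am)).
  rewrite (monicP am) in hN.
  have [||y] := @poly_ivt R a x (Num.max x N).
  - by rewrite le_max lexx.
  - by rewrite ax (le_trans ler01) // hN // le_max lexx orbT.
  - by case/andP=> xy _ ry; exists y.
have [all|/existsNP[x /not_implyP[Bx /negP]]] := pselect (forall x, B < x -> 0 < a.[x]).
  by left.
rewrite -leNgt => /root_right[y xy ry]; right.
have [r rr rM] := poly_root_max a0 ry.
exists r; split; first exact: lt_le_trans Bx (le_trans xy (rM _ ry)).
  exact/eqP.
move=> z rz; rewrite ltNge; apply/negP => /root_right[w zw rw].
by have := lt_le_trans rz (le_trans zw (rM _ rw)); rewrite ltxx.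
Qed.

(** [q / a] is nondecreasing beyond [r] and tends to [0] at infinity for degree
    reasons. *)
Lemma nevanlinna_le0 a q (r : R) : a \is monic -> (size q < size a)%N ->
  (forall x, 0 <= q^`().[x] * a.[x] - q.[x] * a^`().[x]) ->
  (forall x, r < x -> 0 < a.[x]) -> forall x, r <= x -> q.[x] <= 0.
Proof.
move=> am sq W a0.
have lt_case x : r < x -> q.[x] <= 0.
  move=> rx; rewrite leNgt; apply/negP => qx.
  pose k := q.[x] / a.[x].
  have k0 : 0 < k by rewrite divr_gt0 // a0.
  have lk : lead_coef (k *: a - q) = k.
    rewrite lead_coefDl; first by rewrite lead_coefZ (monicP am) mulr1.
    by rewrite size_polyN size_scale // gt_eqF.
  (* If [q / a] reached the value [k > 0], then [k *: a - q] would be nonpositive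
     from there on, but its leading coefficient is [k]. *)
  have [N hN] := @poly_pinfty_gt_lc R (k *: a - q) ltac:(by rewrite lk).
  pose y := Num.max x N.
  have xy : x <= y by rewrite le_max lexx.
  have := hN y; rewrite le_max lexx orbT lk => /(_ isT).
  rewrite !hornerE => h1.
  have := ratio_ndecr W a0 rx xy; rewrite -/k.
  rewrite ler_pdivlMr ?a0 //; first by lra.
  exact: lt_le_trans xy.
move=> x; rewrite le_eqVlt => /predU1P[<-|]; last exact: lt_case.
rewrite -oppr_ge0 -hornerN; apply: horner_ge0_right => y ry.
by rewrite hornerN oppr_ge0 lt_case.
Qed.

(** If [a] had a root beyond [B], both sums would be nonpositive at its last
    root, hence [a] is positive beyond [B] and both quotients by [a] are
    nondecreasing there. A nonpositive value of each of them then makes both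
    nonpositive at the smaller of the two points. *)
Lemma nevanlinna_choice a q1 q2 (B : R) : a \is monic ->
  (size q1 < size a)%N -> (size q2 < size a)%N ->
  (forall x, 0 <= q1^`().[x] * a.[x] - q1.[x] * a^`().[x]) ->
  (forall x, 0 <= q2^`().[x] * a.[x] - q2.[x] * a^`().[x]) ->
  (forall x, B < x -> 0 < (a + q1).[x] + (a + q2).[x]) ->
  (forall x, B < x -> 0 < (a + q1).[x]) \/ (forall x, B < x -> 0 < (a + q2).[x]).
Proof.
move=> am s1 s2 W1 W2 pos.
have [a0|[r [Br ar a0]]] := monic_gt0_or_last_root B am; last first.
  have := pos r Br; rewrite !hornerD ar !add0r ltNge => /negP[].
  have := nevanlinna_le0 am s1 W1 a0 (lexx r).
  have := nevanlinna_le0 am s2 W2 a0 (lexx r); lra.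
have mono q x y : (forall x, 0 <= q^`().[x] * a.[x] - q.[x] * a^`().[x]) ->
    B < x -> x <= y -> (a + q).[y] <= 0 -> (a + q).[x] <= 0.
  move=> W Bx xy; have By := lt_le_trans Bx xy.
  have := ratio_ndecr W a0 Bx xy; rewrite !hornerE => h hy.
  have {}hy : q.[y] / a.[y] <= -1 by rewrite ler_pdivrMr ?a0 //; lra.
  have : q.[x] / a.[x] <= -1 by exact: le_trans hy.
  by rewrite ler_pdivrMr ?a0 //; lra.
have [all|/existsNP[x /not_implyP[Bx /negP]]] :=
  pselect (forall x, B < x -> 0 < (a + q1).[x]); first by left.
rewrite -leNgt => h1; right => y By; rewrite ltNge; apply/negP => h2.
have [xy|/ltW yx] := leP x y.
  have := pos x Bx; have := mono q2 x y W2 Bx xy h2; lra.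
have := pos y By; have := mono q1 y x W1 By yx h1; lra.
Qed.

End Polynomials.

(** * Choosing the signs one by one *)

Section Selection.
Variables (R : realType) (n : nat).
Local Notation C := R[i].
Local Notation Im := (@complex.Im R).
Local Notation toC := (map_poly (real_complex R)).
Local Notation mxC := (map_mx (real_complex R)).
Implicit Types (M N : 'M[R]_n) (l : seq ('I_n * 'I_n)).

(** The average as a polynomial in the spectral parameter, which gives access to
    its real values, its complex values and its leading coefficient at once
    ([horner_avg_char], [hornerC_avg_char], [avg_char_monic]). *)
Fixpoint avg_char l M : {poly R} :=
  if l is p :: l' then
    2^-1 *: (avg_char l' (M + edge_mx R p) + avg_char l' (M - edge_mx R p))
  else char_poly (- M).

Lemma avg_char_monic l M : avg_char l M \is monic /\ size (avg_char l M) = n.+1.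
Proof.
elim: l M => [|p l IH] M /=; first by rewrite char_poly_monic size_char_poly.
have [/monicP m1 s1] := IH (M + edge_mx R p).
have [/monicP m2 s2] := IH (M - edge_mx R p).
set f := avg_char l (M + _) in m1 s1 *; set g := avg_char l (M - _) in m2 s2 *.
have c : (2^-1 *: (f + g))`_n = 1.
  rewrite coefZ coefD; move: m1 m2; rewrite !lead_coefE s1 s2 /= => -> ->.
  by rewrite mulVf // pnatr_eq0.
have s : size (2^-1 *: (f + g)) = n.+1.
  apply/eqP; rewrite eqn_leq; apply/andP; split.
    rewrite (leq_trans (size_scale_leq _ _)) // (leq_trans (size_polyD _ _)) //.
    by rewrite s1 s2 maxnn.
  rewrite ltnNge; apply/negP => h; move: c; rewrite nth_default // => /eqP.
  by rewrite eq_sym oner_eq0.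
split=> //; by apply/monicP; rewrite lead_coefE s.
Qed.

Lemma horner_char_poly (F : fieldType) m (M : 'M[F]_m) (x : F) :
  (char_poly (- M)).[x] = \det (x%:M + M).
Proof.
rewrite /char_poly -[LHS]/(horner_eval x _) -det_map_mx; congr (\det _).
apply/matrixP => i j; rewrite !mxE /= /horner_eval !hornerE opprK.
by case: (i == j); rewrite ?mulr1n ?mulr0n !hornerE.
Qed.

Lemma horner_avg_char l M (x : R) : (avg_char l M).[x] = avg l determinant (x%:M + M).
Proof.
elim: l M => [|p l IH] M /=; first exact: horner_char_poly.
by rewrite !hornerE !IH !addrA mulrC.
Qed.

Lemma map_edge_mx p : mxC (edge_mx R p) = @edge_mx C n p.
Proof. by rewrite map_mxD !map_delta_mx. Qed.

Lemma hornerC_avg_char l M (z : C) :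
  (toC (avg_char l M)).[z] = avg l determinant (z%:M + mxC M).
Proof.
elim: l M => [|p l IH] M /=.
  by rewrite map_char_poly map_mxN horner_char_poly.
rewrite map_polyZ hornerZ rmorphD hornerD !IH (map_mxD _ M) (map_mxB _ M).
by rewrite map_edge_mx !addrA mulrC fmorphV rmorph_nat.
Qed.

Lemma pos_im_shift (z : C) M : M^T = M -> 0 < Im z -> pos_im (z%:M + mxC M).
Proof.
move=> hM hz; apply: pos_im_hermitian; first exact: pos_im_scalar.
apply: hermitian_real; last by rewrite map_trmx hM.
by apply/matrixP => i j; rewrite !mxE conjc_real.
Qed.

(** Otherwise [s = - a / q] would be a zero with negative imaginary part. *)
Lemma Im_mul_conj_ge0 (a q : C) :
  (forall s : C, Im s <= 0 -> a + s * q != 0) -> 0 <= Im (q * conjc a).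
Proof.
move=> h; have [->|q0] := eqVneq q 0; first by rewrite mul0r.
rewrite leNgt; apply/negP => neg.
have /eqP[] : a + (- (a / q)) * q != 0; last by rewrite mulNr divfK // subrr.
apply: h; case: q q0 neg => u v; case: a => b c; rewrite eq_complex /= => uv neg.
have d0 : 0 < u ^+ 2 + v ^+ 2.
  rewrite lt_def addr_ge0 ?sqr_ge0 // paddr_eq0 ?sqr_ge0 // !sqrf_eq0 uv //.
have -> : - (b * - (v / (u ^+ 2 + v ^+ 2)) + c * (u / (u ^+ 2 + v ^+ 2)))
        = (u * - c + v * b) / (u ^+ 2 + v ^+ 2) by field; rewrite gt_eqF.
by rewrite ltW // pmulr_llt0 // invr_gt0.
Qed.

Lemma edge_mxT p : (edge_mx R p)^T = @edge_mx R n p.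
Proof. by rewrite [(_ + _)^T]raddfD /= !trmx_delta addrC. Qed.

Lemma ends_mxT p : (ends_mx R p)^T = @ends_mx R n p.
Proof. by rewrite [(_ + _)^T]raddfD /= !trmx_delta. Qed.

(** For [z] in the upper half plane and [s] in the closed lower one, [a + s q] is
    the average at [z + N - s *: u^T u], which has positive imaginary part. *)
Lemma gram_nevanlinna l N (u : 'rV[R]_n) :
  N^T = N -> forall a q,
  a = avg_char l N -> q = avg_char l (N - u^T *m u) - a -> forall x,
  0 <= q^`().[x] * a.[x] - q.[x] * a^`().[x].
Proof.
move=> hN a q aE qE x; apply: wronskian_ge0 => z hz.
apply: Im_mul_conj_ge0 => s hs.
have ur : map_mx conjc (map_mx (real_complex R) u) = map_mx (real_complex R) u.
  by apply/matrixP => i j; rewrite !mxE conjc_real.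
rewrite qE aE rmorphB hornerD hornerN !hornerC_avg_char map_mxB map_mxM -map_trmx.
set v := map_mx _ u in ur *.
have -> : avg l determinant (z%:M + mxC N) + s * (avg l determinant (z%:M + (mxC N - v^T *m v))
     - avg l determinant (z%:M + mxC N)) = avg l determinant (z%:M + mxC N + s *: ((- v^T) *m v)).
  by rewrite avg_rank1_affine mulNmx !addrA; ring.
apply: avg_stable; rewrite mulNmx scalerN -scaleNr.
apply: pos_imD; first exact: pos_im_shift.
  exact: psd_gram.
by case: s hs => ? ? /=; rewrite oppr_ge0.
Qed.

(** Both signs of [p] subtract a Gram matrix from [M + ends_mx p], so the two
    averages share the comparison polynomial [a] of [nevanlinna_choice]. *)
Lemma sign_choice p l M (B : R) : M^T = M ->
  (forall x, B < x -> 0 < avg (p :: l) determinant (x%:M + M)) ->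
  exists2 s : R, s = 1 \/ s = -1 &
    forall x, B < x -> 0 < avg l determinant (x%:M + (M + s *: edge_mx R p)).
Proof.
move=> hM pos.
pose N := M + ends_mx R p.
have hN : N^T = N by rewrite [(_ + _)^T]raddfD /= hM ends_mxT.
pose a := avg_char l N.
pose qd := avg_char l (N - (diff_row R p)^T *m diff_row R p) - a.
pose qs := avg_char l (N - (sum_row R p)^T *m sum_row R p) - a.
have qdE : a + qd = avg_char l (M + edge_mx R p).
  by rewrite addrC subrK diff_rowM /N opprB addrA addrAC addrK addrC.
have qsE : a + qs = avg_char l (M - edge_mx R p).
  by rewrite addrC subrK sum_rowM /N opprD addrA addrK.
have am : a \is monic by have [] := avg_char_monic l N.
have sz (f : {poly R}) : f \is monic /\ size f = n.+1 -> (size (f - a)%R < size a)%N.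
  have [_ sa] := avg_char_monic l N.
  case=> fm sf; rewrite sa ltnS; apply/leq_sizeP => j nj.
  rewrite coefB; case: (ltngtP n j) nj => // [nj _|<- _].
    by rewrite !nth_default ?subr0 // ?sf ?sa.
  by have := monicP fm; have := monicP am; rewrite !lead_coefE sf sa => -> ->; rewrite subrr.
have := @nevanlinna_choice R a qd qs B am (sz _ (avg_char_monic _ _))
   (sz _ (avg_char_monic _ _)) (gram_nevanlinna hN erefl erefl) (gram_nevanlinna hN erefl erefl).
rewrite qdE qsE => -[x Bx|h|h].
- by have := pos x Bx; rewrite /= !horner_avg_char !addrA; lra.
- by exists 1 => [|x Bx]; [left|have := h x Bx; rewrite scale1r horner_avg_char].
- by exists (-1) => [|x Bx]; [right|have := h x Bx; rewrite scaleN1r horner_avg_char].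
Qed.

(** The edges are listed by labels [e] with ends [g e], which lets the signs form
    a function of the label. *)
Theorem signing_exists (T : eqType) (g : T -> 'I_n * 'I_n) (L : seq T) M (B : R) :
  uniq L -> M^T = M ->
  (forall x, B < x -> 0 < avg (map g L) determinant (x%:M + M)) ->
  exists2 s : T -> R, forall e, s e = 1 \/ s e = -1 &
    forall x, B < x -> 0 < \det (x%:M + (M + \sum_(e <- L) s e *: edge_mx R (g e))).
Proof.
elim: L M => [|e0 L IH] M /=.
  by move=> _ _ pos; exists (fun=> 1) => [e|x Bx]; [left|rewrite big_nil addr0 pos].
case/andP=> e0L uL hM pos.
have [s0 s0P pos0] := sign_choice hM pos.
have hM0 : (M + s0 *: edge_mx R (g e0))^T = M + s0 *: edge_mx R (g e0).
  by rewrite [(_ + _)^T]raddfD /= [(_ *: _)^T]linearZ /= edge_mxT hM.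
have [s sP posL] := IH _ uL hM0 pos0.
exists (fun e => if e == e0 then s0 else s e) => [e|x Bx]; first by case: eqP.
rewrite big_cons eqxx; have := posL x Bx; rewrite -addrA; congr (0 < \det (_ + (_ + (_ + _)))).
by apply: eq_big_seq => e eL; case: eqP => // ee; rewrite -ee eL in e0L.
Qed.

(** A root of the characteristic polynomial in [R[i]] is real: for [z] in the
    upper half plane [z - M] has positive imaginary part, and for [z] in the
    lower one so has [M - z]. *)
Lemma symmetric_lambda_max M : (0 < n)%N -> M^T = M ->
  exists l : R, is_lambda_max M l.
Proof.
move=> n0 hM; pose p := char_poly M.
have p0 : p != 0 by exact/monic_neq0/char_poly_monic.
have : size (toC p) != 1%N.
  by rewrite size_map_poly size_char_poly -lt0n.
case/closed_rootP => z rz.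
have dz : \det (z%:M + mxC (- M)) = 0.
  by apply/eqP; rewrite -horner_char_poly map_mxN opprK -map_char_poly.
have NMT : (- M)^T = - M by rewrite [(- M)^T]raddfN /= hM.
have z_le0 : Im z <= 0.
  rewrite leNgt; apply/negP => hz.
  by have := pos_im_det (pos_im_shift NMT hz); rewrite dz eqxx.
have z_ge0 : 0 <= Im z.
  rewrite leNgt; apply/negP => hz.
  have hNz : 0 < Im (- z) by case: (z) hz => u v /=; rewrite oppr_gt0.
  have := pos_im_det (pos_im_shift hM hNz).
  have -> : (- z)%:M + mxC M = -1 *: (z%:M + mxC (- M)).
    by rewrite scaleN1r opprD map_mxN opprK [(- z)%:M]raddfN.
  by rewrite detZ dz mulr0 eqxx.
have zE : z = (complex.Re z)%:C%C.
  by apply/eqP; rewrite eq_complex /= eqxx /= eq_le z_le0 z_ge0.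
have px : root p (complex.Re z).
  by move: rz; rewrite zE fmorph_root.
have [m pm mM] := poly_root_max p0 px.
exists m; split=> [|x]; rewrite eigenvalue_root_char //.
exact: mM.
Qed.

End Selection.

(** * The recursion of the matching polynomial *)

Section PrincipalMinors.
Variables (F : numFieldType) (n : nat).
Implicit Types (M N : 'M[F]_n) (S : {set 'I_n}) (u v : 'I_n)
  (p q : 'I_n * 'I_n) (l : seq ('I_n * 'I_n)).

Definition set_row u (r : 'rV[F]_n) M : 'M[F]_n :=
  \matrix_(i, j) if i == u then r 0 j else M i j.

Lemma det_add_delta c u v M :
  \det (M + c *: delta_mx u v) = \det M + c * \det (set_row u (delta_mx 0 v) M).
Proof.
rewrite -[\det M]mul1r; apply: (@determinant_multilinear _ _ _ _ _ u).
- by apply/rowP => j; rewrite !mxE !eqxx mul1r.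
- apply/matrixP => i j; rewrite !mxE.
  by rewrite eq_sym (negPf (neq_lift _ _)) mulr0 addr0.
- apply/matrixP => i j; rewrite !mxE.
  by rewrite eq_sym (negPf (neq_lift _ _)) mulr0 addr0.
Qed.

Lemma det_set_row_swap u v M : u != v ->
  \det (set_row v (delta_mx 0 u) (set_row u (delta_mx 0 v) M)) =
  - \det (set_row v (delta_mx 0 v) (set_row u (delta_mx 0 u) M)).
Proof.
move=> uv.
have -> : set_row v (delta_mx 0 u) (set_row u (delta_mx 0 v) M) =
  xrow u v (set_row v (delta_mx 0 v) (set_row u (delta_mx 0 u) M)).
  apply/matrixP => i j; rewrite !mxE.
  case: tpermP => [->|->|/eqP/negPf iu /eqP/negPf iv].
  - by rewrite (negPf uv) !eqxx.
  - by rewrite !eqxx (negPf uv).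
  - by rewrite iv iu.
by rewrite xrowE det_mulmx det_perm odd_tperm uv expr1 mulN1r.
Qed.

(** The principal minor on [S]. Replacing the other rows by those of the identity
    keeps all minors within one matrix type; the columns outside [S] then
    do not matter ([eq_pdet]). *)
Definition pdet S M : F :=
  \det (\matrix_(i, j) if i \in S then M i j else (i == j)%:R).

Lemma pdetT M : pdet [set: 'I_n] M = \det M.
Proof. by congr (\det _); apply/matrixP => i j; rewrite mxE inE. Qed.

Lemma pdet0 M : pdet set0 M = 1.
Proof.
by rewrite -(det1 F n); congr (\det _); apply/matrixP => i j; rewrite !mxE inE.
Qed.

(** A permutation contributes only if it fixes every index outside [S], and then
    it maps [S] to itself. *)
Lemma eq_pdet S M N : {in S &, forall i j, M i j = N i j} -> pdet S M = pdet S N.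
Proof.
move=> MN; apply: eq_bigr => s _; congr (_ * _).
have [fixC|/forall_inPn[i iS si]] := boolP [forall (i | i \notin S), s i == i].
  apply: eq_bigr => i _; rewrite !mxE; case: ifP => // iS; apply: MN => //.
  apply: contraT => siS; have := forall_inP fixC _ siS => /eqP/perm_inj sii.
  by rewrite sii iS in siS.
have z (A : 'M[F]_n) :
    \prod_k (\matrix_(i, j) if i \in S then A i j else (i == j)%:R) k (s k) = 0.
  by rewrite (bigD1 i) //= mxE (negPf iS) eq_sym (negPf si) mul0r.
by rewrite !z.
Qed.

(** Expansion along a diagonal row. *)
Lemma pdet_diag u S x M : u \in S -> (forall j, M u j = x *+ (u == j)) ->
  pdet S M = x * pdet (S :\ u) M.
Proof.
move=> uS Mu; rewrite -[x * _]addr0 -[X in _ + X](mul0r (pdet (S :\ u) M)).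
have off i : lift u i \in S :\ u = (lift u i \in S).
  by rewrite !inE eq_sym neq_lift.
apply: (@determinant_multilinear _ _ _ _ _ u).
- apply/rowP => j; rewrite !mxE uS !inE eqxx /= mul0r addr0 Mu.
  by rewrite mulr_natr.
- by apply/matrixP => i j; rewrite !mxE off.
- by apply/matrixP => i j; rewrite !mxE off.
Qed.

(** The minor is quadratic in the sign [c]; the linear part cancels in the mean
    and [c ^+ 2 = 1] multiplies the term in which rows [u] and [v] are
    exchanged unit vectors, whence the minus sign. *)
Lemma pdet_edge S p M : p.1 != p.2 -> p.1 \in S -> p.2 \in S ->
  (pdet S (M + edge_mx F p) + pdet S (M - edge_mx F p)) / 2 =
  pdet S M - pdet (S :\ p.1 :\ p.2) M.
Proof.
case: p => u v /= uv uS vS.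
pose K (T : {set 'I_n}) (A : 'M[F]_n) : 'M[F]_n :=
  \matrix_(i, j) if i \in T then A i j else (i == j)%:R.
have KE c : K S (M + c *: edge_mx F (u, v)) =
    K S M + c *: delta_mx u v + c *: delta_mx v u.
  apply/matrixP => i j; rewrite !mxE /=; case: ifP => iS; first by rewrite mulrDr addrA.
  have /negPf-> : i != u by apply: contraFN iS => /eqP->.
  have /negPf-> : i != v by apply: contraFN iS => /eqP->.
  by rewrite !mulr0 !addr0.
have detK c : pdet S (M + c *: edge_mx F (u, v)) = pdet S M
   + c * \det (set_row u (delta_mx 0 v) (K S M))
   + c * \det (set_row v (delta_mx 0 u) (K S M)) - c ^+ 2 * pdet (S :\ u :\ v) M.
  rewrite /pdet -/(K S _) KE det_add_delta det_add_delta.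
  have -> : set_row v (delta_mx 0 u) (K S M + c *: delta_mx u v) =
      set_row v (delta_mx 0 u) (K S M) + c *: delta_mx u v.
    apply/matrixP => i j; rewrite !mxE; case: (eqVneq i v) => // ->.
    by rewrite [v == u]eq_sym (negPf uv) mulr0 addr0.
  rewrite det_add_delta.
  have -> : \det (set_row u (delta_mx 0 v) (set_row v (delta_mx 0 u) (K S M))) =
     - pdet (S :\ u :\ v) M.
    rewrite det_set_row_swap 1?eq_sym //; congr (- \det _).
    apply/matrixP => i j; rewrite !mxE !inE.
    case: (eqVneq i u) => [->|_] /=; first by rewrite andbF eq_sym.
    by case: (eqVneq i v) => [->|_] //=; rewrite eq_sym.
  by rewrite /pdet; ring.
have := detK 1; have := detK (-1); rewrite scale1r scaleN1r => -> ->.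
by field.
Qed.

(** The sign of an edge may be averaged before or after the others. *)
Lemma avg_consr p l f M : avg (p :: l) f M =
  avg l (fun N => (f (N + edge_mx F p) + f (N - edge_mx F p)) / 2) M.
Proof.
elim: l M => [|q l IH] M //=.
rewrite -!IH /= !(addrAC M (edge_mx F p)) !(addrAC M (- edge_mx F p)).
by field.
Qed.

Lemma eq_avg l f g M : f =1 g -> avg l f M = avg l g M.
Proof. by move=> fg; elim: l M => [|p l IH] M /=; rewrite ?fg ?IH. Qed.

Lemma avgB l f g M : avg l (fun N => f N - g N) M = avg l f M - avg l g M.
Proof. by elim: l M => [|p l IH] M //=; rewrite !IH; field. Qed.

Lemma avg_pdet_inside p l S M : p.1 != p.2 -> p.1 \in S -> p.2 \in S ->
  avg (p :: l) (pdet S) M = avg l (pdet S) M - avg l (pdet (S :\ p.1 :\ p.2)) M.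
Proof.
move=> p12 p1 p2; rewrite avg_consr -avgB; apply: eq_avg => N.
exact: pdet_edge.
Qed.

Lemma avg_pdet_outside p l S M : ~~ ((p.1 \in S) && (p.2 \in S)) ->
  avg (p :: l) (pdet S) M = avg l (pdet S) M.
Proof.
move=> pS; rewrite avg_consr; apply: eq_avg => N.
have E0 i j : i \in S -> j \in S -> edge_mx F p i j = 0.
  move=> iS jS; rewrite !mxE.
  have /negPf-> : ~~ ((i == p.1) && (j == p.2)).
    by apply: contra pS => /andP[/eqP<- /eqP<-]; rewrite iS.
  have /negPf-> : ~~ ((i == p.2) && (j == p.1)).
    by apply: contra pS => /andP[/eqP<- /eqP<-]; rewrite jS.
  by rewrite addr0.
rewrite (@eq_pdet S (N + _) N); last by move=> i j iS jS; rewrite mxE E0 ?addr0.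
rewrite (@eq_pdet S (N - _) N); last by move=> i j iS jS; rewrite mxE [X in _ + X]mxE E0 ?subr0.
by field.
Qed.

Lemma avg_pdet0 l M : avg l (pdet set0) M = 1.
Proof.
by elim: l => [|p l IH]; [exact: pdet0|rewrite avg_pdet_outside ?inE].
Qed.

Definition touches u p := (p.1 == u) || (p.2 == u).
Definition inside S p := (p.1 \in S) && (p.2 \in S).

Lemma touches_outside u S p : u \notin S -> touches u p -> ~~ inside S p.
Proof.
by move=> /negPf uS /orP[] /eqP E; rewrite /inside E uS ?andbF.
Qed.

Lemma touches_removed u S p : touches u p -> u \notin S :\ p.1 :\ p.2.
Proof. by case/orP => /eqP <-; rewrite !inE eqxx ?andbF. Qed.

(** Remove the edges at [u] one by one with [avg_pdet_inside]. Once [u] has been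
    removed, the edges at [u] no longer matter and can be put back, which is
    why all averages run over the same list. *)
Lemma avg_pdet_vertex u S l M x : u \in S -> all (fun p => p.1 != p.2) l ->
  (forall j, M u j = x *+ (u == j)) ->
  avg l (pdet S) M = x * avg l (pdet (S :\ u)) M
   - \sum_(p <- l | touches u p && inside S p) avg l (pdet (S :\ p.1 :\ p.2)) M.
Proof.
move=> uS; elim: l M => [|p l IH] M.
  by move=> _ Mu; rewrite big_nil subr0 /= -pdet_diag.
case/andP=> p12 lP Mu; have [pu|pu] := boolP (touches u p).
  have outE (T : {set 'I_n}) : u \notin T -> avg (p :: l) (pdet T) M = avg l (pdet T) M.
    by move=> uT; apply: avg_pdet_outside; exact: touches_outside pu.
  have sumE : \sum_(q <- l | touches u q && inside S q)
       avg (p :: l) (pdet (S :\ q.1 :\ q.2)) M =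
      \sum_(q <- l | touches u q && inside S q) avg l (pdet (S :\ q.1 :\ q.2)) M.
    by apply: eq_bigr => q /andP[uq _]; apply/outE/touches_removed.
  rewrite big_cons pu sumE (outE (S :\ u)) ?setD11 // andTb.
  have [pS|pS] := boolP (inside S p).
    have /andP[p1 p2] := pS.
    rewrite (outE (_ :\ _)) ?touches_removed // avg_pdet_inside // (IH M lP Mu).
    by rewrite opprD addrA addrAC.
  by rewrite avg_pdet_outside // (IH M lP Mu).
have off j : edge_mx F p u j = 0.
  rewrite !mxE; move: pu; rewrite /touches negb_or ![_ == u]eq_sym.
  by case/andP => /negPf-> /negPf->; rewrite addr0.
rewrite [LHS]/= !IH //; first last.
- by move=> j; rewrite mxE off Mu addr0.
- by move=> j; rewrite mxE [X in _ + X]mxE off Mu subr0.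
by rewrite big_cons (negPf pu) /= -mulr_suml big_split /=; field.
Qed.

End PrincipalMinors.

(** * Positivity beyond twice the square root of the degree minus one *)

Section PositivityBeyondBound.
Variables (F : realFieldType) (n : nat).
Implicit Types (S : {set 'I_n}) (u v : 'I_n) (p q : 'I_n * 'I_n).
Variables (k x : F) (l : seq ('I_n * 'I_n)) (d : nat).
Hypotheses (k1 : 1 <= k) (k2 : k ^+ 2 = d%:R - 1) (xk : 2 * k < x).
Hypotheses (lP : all (fun p => p.1 != p.2) l)
  (deg : forall u, (count (touches u) l <= d)%N).

Let f S := avg l (pdet S) (x%:M).

Lemma avg_pdet_rec u S : u \in S ->
  f S = x * f (S :\ u) - \sum_(p <- l | touches u p && inside S p) f (S :\ p.1 :\ p.2).
Proof. by move=> uS; apply: avg_pdet_vertex => // j; rewrite mxE. Qed.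

(** With [k = sqrt (d - 1)]. Each vertex [v] whose edge to [u] lies inside [S]
    sends that edge out of [S - u], so by induction
    [f (S - u - v) <= f (S - u) / k]. If there are [m] such edges, then
    [f S >= (x - m / k) * f (S - u)]. When [u] has an edge leaving [S], then
    [m <= d - 1 = k ^+ 2] and the factor is at least [k]; in general [m <= d]
    and the factor is still positive since [x > 2 k >= k + 1 / k]. *)
Lemma avg_pdet_ratio m S : (#|S| <= m)%N -> 0 < f S /\
  forall u, u \in S -> has (fun p => touches u p && ~~ inside S p) l ->
  k * f (S :\ u) <= f S.
Proof.
elim: m S => [|m IH] S.
  rewrite leqn0 cards_eq0 => /eqP->; split=> [|u]; last by rewrite inE.
  by rewrite /f avg_pdet0.
move=> Sm; have k0 : 0 < k by exact: lt_le_trans ltr01 k1.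
have step u : u \in S -> 0 < f (S :\ u) /\
   (x - (count (fun p => touches u p && inside S p) l)%:R / k) * f (S :\ u) <= f S.
  move=> uS; have Su : (#|S :\ u| <= m)%N.
    by rewrite -ltnS; apply: leq_trans Sm; rewrite [in X in (_ < X)%N](cardsD1 u) uS.
  have [fSu ratio] := IH _ Su; split=> //.
  rewrite (avg_pdet_rec uS) mulrBl lerD2l lerN2.
  have : \sum_(p <- l | touches u p && inside S p) f (S :\ p.1 :\ p.2) <=
      \sum_(p <- l | touches u p && inside S p) f (S :\ u) / k.
    rewrite big_seq_cond [X in _ <= X]big_seq_cond.
    apply: ler_sum => q /andP[ql /andP[uq qS]].
    have q12 := allP lP _ ql; have /andP[q1 q2] := qS.
    rewrite ler_pdivlMr // mulrC.
    have useIH v : v \in S :\ u -> touches v q -> k * f (S :\ u :\ v) <= f (S :\ u).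
      move=> vS vq; apply: ratio => //; apply/hasP; exists q => //.
      by rewrite vq (touches_outside _ uq) // !inE eqxx.
    case/orP: (uq) => /eqP uE.
      rewrite uE; apply: useIH; first by rewrite !inE q2 -uE eq_sym q12.
      by rewrite /touches eqxx orbT.
    rewrite setDDl setUC -setDDl uE; apply: useIH; first by rewrite !inE q1 -uE q12.
    by rewrite /touches eqxx.
  move/le_trans; apply; rewrite big_const_seq iter_addr_0.
  by rewrite -[_ *+ _]mulr_natl mulrA mulrAC.
have countE u : (count (fun p => touches u p && inside S p) l
     + count (fun p => touches u p && ~~ inside S p) l)%N = count (touches u) l.
  rewrite -(size_filter (touches u)) -(count_predC (inside S)) !count_filter.
  by congr addn; apply: eq_count => q /=; rewrite andbC.
have kk : k * k = d%:R - 1 by rewrite -expr2.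
have half u : u \in S -> has (fun p => touches u p && ~~ inside S p) l ->
    k * f (S :\ u) <= f S.
  move=> uS hout; have [fSu le_fS] := step u uS.
  apply: le_trans le_fS; rewrite ler_pM2r //.
  have : (count (fun p => touches u p && inside S p) l < d)%N.
    apply: leq_trans (deg u); rewrite -countE -addn1 leq_add2l.
    by rewrite -has_count.
  rewrite -(ler_nat F) -addn1 natrD => cd.
  rewrite lerBrDr -lerBrDl ler_pdivrMr // mulrBl kk.
  have : k * (2 * k) <= x * k by rewrite mulrC ler_pM2r // ltW.
  by rewrite mulrCA kk; lra.
split=> //; have [->|[u uS]] := set_0Vmem S; first by rewrite /f avg_pdet0.
have [fSu le_fS] := step u uS.
apply: lt_le_trans le_fS; rewrite pmulr_lgt0 // subr_gt0 ltr_pdivrMr //.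
have : (count (fun p => touches u p && inside S p) l <= d)%N.
  by apply: leq_trans (deg u); rewrite -countE leq_addr.
rewrite -(ler_nat F) => cd.
have : k * (2 * k) < x * k by rewrite mulrC ltr_pM2r.
have : 1 <= k * k by rewrite -[1]mulr1 ler_pM.
rewrite mulrCA kk; lra.
Qed.

Lemma avg_det_gt0 : 0 < avg l determinant (x%:M).
Proof.
have [] := avg_pdet_ratio (leqnn #|[set: 'I_n]|).
by rewrite /f (eq_avg _ _ (@pdetT _ _)).
Qed.

End PositivityBeyondBound.

(** * Signings of a regular graph *)

Section Graphs.
Variables (V : finType) (E : {set {set V}}).

Definition is_ends (e : {set V}) (p : 'I_#|V| * 'I_#|V|) :=
  (p.1 != p.2) && (e == [set enum_val p.1; enum_val p.2]).

Lemma is_ends_exists (e : {set V}) : #|e| = 2%N -> exists p, is_ends e p.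
Proof.
move=> /eqP/cards2P => -[a [b [ab ->]]]; exists (enum_rank a, enum_rank b).
by rewrite /is_ends /= !enum_rankK eqxx andbT (inj_eq enum_rank_inj).
Qed.

Lemma edge_mx_adjmx (R : realType) e p :
  is_ends e p -> edge_mx R p = adjmx R [set e].
Proof.
case: p => a b /andP[/= ab /eqP ->]; apply/matrixP => i j.
rewrite !mxE /= inE.
have -> : ([set enum_val i; enum_val j] == [set enum_val a; enum_val b]) =
    (i == a) && (j == b) || (i == b) && (j == a).
  apply/eqP/orP => [h|[] /andP[/eqP-> /eqP->]] //; last by rewrite setUC.
  have mem (x : 'I_#|V|) : (enum_val x \in [set enum_val i; enum_val j]) = (x == a) || (x == b).
    by rewrite h !inE !(inj_eq enum_val_inj).
  have memij (x : 'I_#|V|) : (x == i) || (x == j) = (x == a) || (x == b).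
    by rewrite -mem !inE !(inj_eq enum_val_inj).
  have := memij a; have := memij b; have := memij i.
  rewrite !eqxx !orbT !orTb => /esym/orP[]/eqP-> hb ha; [left|right].
    by move: hb; rewrite eq_sym (negPf ab) /= eqxx [b == j]eq_sym => ->.
  by move: ha; rewrite (negPf ab) /= eqxx [a == j]eq_sym => ->.
case: (eqVneq i a) => [->|_] /=; last by rewrite add0r.
by rewrite (negPf ab) /= addr0 orbF.
Qed.

Lemma signed_adjmxT (R : realType) (s : {set V} -> R) :
  (signed_adjmx E s)^T = signed_adjmx E s.
Proof.
apply/matrixP => i j; rewrite mxE !summxE; apply: eq_bigr => e _.
by rewrite !mxE setUC.
Qed.

Lemma degree_count (d : nat) (g : {set V} -> 'I_#|V| * 'I_#|V|) u :
  regular d E -> (forall e, e \in E -> is_ends e (g e)) ->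
  (count (touches u) (map g (enum E)) <= d)%N.
Proof.
move=> reg gP; rewrite -(reg (enum_val u)) count_map -size_filter.
apply: leq_trans (leq_imset_card (fun b => [set enum_val u; b]) _).
rewrite cardE; apply: uniq_leq_size; first by rewrite filter_uniq // enum_uniq.
move=> e; rewrite mem_filter !mem_enum => /andP[/= tu eE].
have /andP[_ /eqP eg] := gP e eE; apply/imsetP.
case/orP: tu => /eqP gu; rewrite gu in eg.
  by exists (enum_val (g e).2) => //; rewrite inE -eg.
by exists (enum_val (g e).1); rewrite ?inE setUC -eg.
Qed.

End Graphs.

Theorem theorem1p2 (R : realType) (V : finType) (E : {set {set V}}) (d : nat)
    (V_nonempty : (0 < #|V|)%N) (d_ge2 : (2 <= d)%N)
    (E_simple : simple_graph E) (E_regular : regular d E) :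
  exists As : 'M[R]_#|V|,
    is_signing E As /\
    exists2 l : R, is_lambda_max As l & l <= 2 * Num.sqrt (d%:R - 1).
Proof.
set k : R := Num.sqrt _.
pose i0 := Ordinal V_nonempty.
pose g e := odflt (i0, i0) [pick p | is_ends e p].
have gP e : e \in E -> is_ends e (g e).
  move=> eE; rewrite /g; case: pickP => [p //|no].
  by have [p] := is_ends_exists (E_simple e eE); rewrite no.
have d1 : 1 <= d%:R - 1 :> R by rewrite lerBrDr -(natrD R 1 1) ler_nat.
have k1 : 1 <= k by rewrite -sqrtr1 ler_wsqrtr.
have k2 : k ^+ 2 = d%:R - 1 by rewrite sqr_sqrtr // (le_trans ler01).
have gne : all (fun p => p.1 != p.2) (map g (enum E)).
  by apply/allP => _ /mapP[e + ->]; rewrite mem_enum => /gP/andP[].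
have pos x : 2 * k < x -> 0 < avg (map g (enum E)) determinant (x%:M + 0 : 'M[R]_#|V|).
  move=> kx; rewrite addr0; apply: (avg_det_gt0 k1 k2 kx gne) => u.
  exact: degree_count.
have [s sP spos] := signing_exists (enum_uniq E) (trmx0 _ _ _) pos.
(* The averaged determinants add the edges to [x], while a characteristic
   polynomial subtracts the matrix: the signs are reversed. *)
pose A := signed_adjmx E (fun e => - s e).
have sumE : \sum_(e <- enum E) s e *: edge_mx R (g e) = - A.
  rewrite /A /signed_adjmx big_enum -sumrN /=; apply: eq_bigr => e eE.
  by rewrite scaleNr opprK (edge_mx_adjmx _ (gP e eE)).
exists A; split.
  exists (fun e => - s e) => // e _.
  by case: (sP e) => ->; [right|left; rewrite opprK].
have [l lmax] := symmetric_lambda_max V_nonempty (signed_adjmxT E (fun e => - s e)).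
exists l => //; case: lmax; rewrite eigenvalue_root_char => /eqP rl _.
rewrite leNgt; apply/negP => /spos.
by rewrite sumE add0r -horner_char_poly opprK rl ltxx.
Qed.
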